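(* Let $A\subseteq \mathbb{R}$ be such that $\mathbb{R}\setminus A$ is uncountable and analytic. Then $C_p(H(A))$ is not normal.
   Context: For $A\subseteq\mathbb{R}$, the Hattori space $H(A)$ is the set $\mathbb{R}$ with the topology $\tau(A)$ in which a point $x\in A$ has the local base $\{(x-\varepsilon,x+\varepsilon) : \varepsilon>0\}$ and a point $x\in\mathbb{R}\setminus A$ has the local base $\{[x,x+\varepsilon) : \varepsilon>0\}$. $C_p(X)$ is the space of continuous real-valued functions on $X$ with the topology of pointwise convergence. ''Analytic'' is meant with respect to the Euclidean topology on $\mathbb{R}$. *)

(* Defs.v *)
From HB Require Import structures.
From mathcomp Require Import all_boot all_order all_algebra.
From mathcomp Require Import all_classical all_reals all_analysis.

Set Implicit Arguments.
Unset Strict Implicit.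
Unset Printing Implicit Defensive.

Import Order.TTheory GRing.Theory Num.Theory.
Import numFieldNormedType.Exports.

Local Open Scope classical_set_scope.
Local Open Scope ring_scope.

(** An alias of [R], so that the topology below does not clash with the
    Euclidean one. *)
Definition hattori (R : realType) (A : set R) : Type := R.

Section hattori_topology.
Context {R : realType} (A : set R).
Implicit Types (x y : R) (U V : set R).

Definition hattori_base x (e : R) : set R :=
  if x \in A then `]x - e, x + e[%classic else `[x, x + e[%classic.

Definition hattori_nbhs x : set_system R :=
  filter_from [set e | 0 < e] (hattori_base x).

Lemma hattori_base_center x e : 0 < e -> hattori_base x e x.
Proof.
by move=> e0; rewrite /hattori_base; case: ifP => _;
  rewrite /= in_itv/= ?lexx ?ltrBlDr ltrDl ?e0.
Qed.

Lemma hattori_base_le x e e' :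
  e <= e' -> hattori_base x e `<=` hattori_base x e'.
Proof.
move=> ee' y; rewrite /hattori_base; case: ifP => _;
  rewrite /= !in_itv/= => /andP[xy yx]; apply/andP; split.
- by apply: le_lt_trans xy; rewrite lerB.
- by apply: lt_le_trans yx _; rewrite lerD2l.
- by [].
- by apply: lt_le_trans yx _; rewrite lerD2l.
Qed.

Lemma hattori_base_sub x e y : hattori_base x e y ->
  exists2 d, 0 < d & hattori_base y d `<=` hattori_base x e.
Proof.
have itv_sub d z : 0 < d -> hattori_base y d z -> y - d < z < y + d.
  move=> d0; rewrite /hattori_base; case: ifP => _; rewrite /= in_itv//=.
  by move=> /andP[yz ->]; rewrite andbT (lt_le_trans _ yz)// ltrBlDr ltrDl.
rewrite {1 3}/hattori_base; case: ifP => xA.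
  rewrite /= in_itv/= => /andP[xy yx].
  exists (Num.min (y - (x - e)) (x + e - y)).
    by rewrite lt_min !subr_gt0 xy yx.
  move=> z /itv_sub; rewrite lt_min !subr_gt0 xy yx => /(_ isT) /andP[yz zy].
  rewrite /= in_itv/=; apply/andP; split.
    by apply: le_lt_trans yz; rewrite lerBrDl -lerBrDr ge_min lexx.
  by apply: lt_le_trans zy _; rewrite -lerBrDl ge_min lexx orbT.
rewrite /= in_itv/= => /andP[]; rewrite le_eqVlt => /predU1P[<- e0|xy yx].
  exists e; first by rewrite -(ltrDl x).
  by move=> z; rewrite /hattori_base xA.
exists (Num.min (y - x) (x + e - y)); first by rewrite lt_min !subr_gt0 xy yx.
move=> z /itv_sub; rewrite lt_min !subr_gt0 xy yx => /(_ isT) /andP[yz zy].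
rewrite /= in_itv/=; apply/andP; split.
  by apply/ltW/(le_lt_trans _ yz); rewrite lerBrDl -lerBrDr ge_min lexx.
by apply: lt_le_trans zy _; rewrite -lerBrDl ge_min lexx orbT.
Qed.

Lemma hattori_nbhs_filter x : ProperFilter (hattori_nbhs x).
Proof.
apply: filter_from_proper; last first.
  by move=> e /= e0; exists x; exact: hattori_base_center.
apply: filter_from_filter; first by exists 1 => /=.
move=> e e' /= e0 e'0; exists (Num.min e e') => /=.
  by rewrite lt_min e0 e'0.
by move=> y xy; split; apply: hattori_base_le xy; rewrite ge_min lexx ?orbT.
Qed.

Lemma hattori_nbhs_singleton x U : hattori_nbhs x U -> U x.
Proof. by case=> e /= e0; apply; exact: hattori_base_center. Qed.

Lemma hattori_nbhs_nbhs x U :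
  hattori_nbhs x U -> hattori_nbhs x (hattori_nbhs^~ U).
Proof.
case=> e /= e0 xeU; exists e => //= y /hattori_base_sub[d d0 ydxe].
by exists d => //=; exact: subset_trans xeU.
Qed.

HB.instance Definition _ := Choice.on (hattori A).
HB.instance Definition _ := hasNbhs.Build (hattori A) hattori_nbhs.
HB.instance Definition _ := @Nbhs_isNbhsTopological.Build (hattori A)
  hattori_nbhs_filter hattori_nbhs_singleton hattori_nbhs_nbhs.

End hattori_topology.

Definition Cp (R : realType) (X : topologicalType) : Type := continuousType X R.

HB.instance Definition _ (R : realType) (X : topologicalType) :=
  Choice.copy (Cp R X) (continuousType X R).
HB.instance Definition _ (R : realType) (X : topologicalType) :=
  Topological.copy (Cp R X)
    (initial_topology
      (fun f : Cp R X => (f : continuousType X R) : {ptws X -> R})).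

Definition separable (T : topologicalType) :=
  exists2 D : set T, countable D & dense D.

Definition complete_metric (R : realType) (Y : metricType R) :=
  forall u : nat -> Y, cauchy (u @ \oo) -> exists l : Y, u @ \oo --> l.

(** Analytic subsets of the Euclidean line: the continuous images of Polish
    spaces. A metric type may be empty, so the empty set is analytic. *)
Definition analytic (R : realType) (S : set R) :=
  exists (Y : metricType R) (f : Y -> R),
    [/\ complete_metric Y, separable Y, continuous f & range f = S].

(* Main.v *)
Require Import Defs.
From mathcomp Require Import all_boot all_order all_algebra.
From mathcomp Require Import all_classical all_reals all_analysis.
From mathcomp Require Import ring lra.

Set Implicit Arguments.
Unset Strict Implicit.
Unset Printing Implicit Defensive.

Import Order.TTheory GRing.Theory Num.Theory.
Import numFieldNormedType.Exports.

Local Open Scope classical_set_scope.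
Local Open Scope ring_scope.

(** [Cp R (hattori A)] is separable, since the rational polynomials are dense in
    it. By Jones' lemma it then suffices to find a closed discrete subset of
    cardinality continuum. As the complement of [A] is uncountable and analytic,
    a Cantor scheme yields a continuous strictly increasing (for the
    lexicographic order) map [phi] from the Cantor space into it. Put
    [x a := phi (0, a)] and [y a := phi (1, ~ a)]; when [x a] increases, [y a]
    decreases. The indicator functions of the [[x a, y a[] are continuous on
    [hattori A] because the endpoints avoid [A]. The values at [x a] and [y a]
    isolate the [a]-th one among the others. A pointwise limit of them has its
    jumps in the two compact sets [range x] and [range y], hence off [A]. If it
    is continuous on [hattori A], it is therefore right-continuous at its jumps,
    which forces it to be one of the indicator functions. *)

(** * Normality against separability and closed discrete families *)

(** Jones' lemma: [B |-> U B `&` D], where [U B] separates [g @` B] from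
    [g @` ~` B], would embed the subsets of [nat -> bool] into those of the
    countable set [D]. *)
Lemma separable_closed_discrete_not_normal (T : topologicalType)
    (g : (nat -> bool) -> T) :
  separable T -> injective g -> (forall B, closed (g @` B)) ->
  ~ normal_space T.
Proof.
move=> [D /countable_injP[i iinj] denseD] ginj gclosed normalT.
have sepP (B : set (nat -> bool)) : exists U : set T,
    g @` B `<=` U° /\ closure U `<=` ~` (g @` ~` B).
  have [|U /set_nbhsP[V [oV gV VU]] UB] :=
    normalT _ (gclosed B) (~` (g @` ~` B)).
    apply/set_nbhsP; exists (~` (g @` ~` B)); split=> //.
      exact/closed_openC/gclosed.
    by move=> _ [a Ba <-] [b nBb /ginj ab]; apply: nBb; rewrite ab.
  exists U; split=> // t /gV Vt; rewrite /interior/=; apply: filterS VU _.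
  exact: open_nbhs_nbhs.
have {sepP}[U UP] := choice sepP.
pose code B n := `[< exists2 d, D d /\ i d = n & (U B)° d >].
have code_sub B C : code B = code C -> B `<=` C.
  move=> BC a Ba; apply: contrapT => nCa.
  have [sU _] := UP B; have [_ sV] := UP C.
  (* If [a] lies in [B] but not in [C], then [g a] lies in this open set, and density puts there a
     point of [D] that the two codes treat differently. *)
  have [||d [[Ud Vd] Dd]] := denseD ((U B)° `&` ~` closure (U C)).
  - exists (g a); split; [by apply: sU; exists a|].
    by move=> /sV; apply; exists a.
  - by apply: openI; [exact: open_interior | exact/closed_openC/closed_closure].
  have : code B (i d) by apply/asboolP; exists d.
  rewrite BC => /asboolP[d' [Dd' /iinj]]; rewrite !inE => /(_ Dd' Dd) -> Ud'.
  exact: Vd (subset_closure (interior_subset Ud')).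
(* Cantor's diagonal argument: a code is itself a point of [nat -> bool], and [code_sub] makes a set
   recoverable from its code. *)
pose B0 := [set a | exists2 B, code B = a & ~ B a].
have nB0 : ~ B0 (code B0).
  by case=> B eB nB; apply/nB/(code_sub _ _ (esym eB)); exists B.
by apply: (nB0); exists B0.
Qed.

(** * Pointwise convergence and separability of the function space *)

Lemma Cp_eval_continuous (R : realType) (X : topologicalType) (x : X) :
  continuous (fun f : Cp R X => f x).
Proof.
move=> f; pose emb (h : Cp R X) : {ptws X -> R} := h.
have embf : {ptws, emb @ nbhs f --> emb f} by exact: initial_continuous.
have FF : Filter (emb @ nbhs f) by apply: fmap_filter; exact: nbhs_filter.
exact: ((pointwise_cvgP _ FF).1 embf x).
Qed.

(** The sets [base (s, e)] generate a filter that converges pointwise to [f], so it contains every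
    pointwise neighbourhood of [f]. *)
Lemma Cp_nbhs_basis (R : realType) (X : topologicalType) (f : Cp R X)
    (U : set (Cp R X)) : nbhs f U ->
  exists (s : seq X) (e : R), 0 < e /\
    forall g : Cp R X, (forall x, x \in s -> `|f x - g x| < e) -> U g.
Proof.
rewrite nbhsE => -[_ [[W oW <-] Wf] WU].
pose base (se : seq X * R) :=
  [set h : X -> R | forall x, x \in se.1 -> `|f x - h x| < se.2].
pose F := filter_from [set se : seq X * R | 0 < se.2] base.
have FF : Filter F.
  apply: filter_from_filter; first by exists ([::], 1) => /=.
  move=> [s e] [t d] /= e0 d0; exists (s ++ t, Num.min e d) => /=.
    by rewrite lt_min e0 d0.
  by move=> h hst; split=> x xs; have := hst x; rewrite mem_cat xs ?orbT lt_min
    => /(_ isT) /andP[].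
have Ff : {ptws, F --> (f : X -> R)}.
  apply/pointwise_cvgP => x; apply/cvgrPdist_lt => e e0.
  by exists ([:: x], e) => //= h /(_ x); apply; rewrite mem_head.
have [[s e] /= e0 sW] : F W by apply: Ff; exact: open_nbhs_nbhs.
by exists s, e; split=> // g gs; apply: WU; exact: sW.
Qed.

Lemma hattori_continuous (R : realType) (A : set R) (f : R -> R) :
  continuous f -> continuous (f : hattori A -> R).
Proof.
move=> fc x; apply: cvg_trans (fc x); apply: cvg_app => U.
move=> /nbhs_ballP[e /= e0 eU]; exists e => //= y xy; apply: eU.
apply: ball_sym; rewrite /ball/= ltr_distl; move: xy; rewrite /hattori_base.
by case: ifP => _; rewrite /= in_itv/= => /andP[? ?]; apply/andP;
  split => //; lra.
Qed.

(** As in Newton interpolation, a multiple of the polynomial [w] with root set [s] corrects the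
    value at a new point and leaves those on [s] alone. *)
Lemma poly_interpolation (F : fieldType) (s : seq F) (v : F -> F) :
  exists p : {poly F}, forall x, x \in s -> p.[x] = v x.
Proof.
elim: s => [|x s [p ps]]; first by exists 0.
have [xs|xs] := boolP (x \in s).
  by exists p => y; rewrite inE => /predU1P[->|]; exact: ps.
pose w := \prod_(y <- s) ('X - y%:P).
exists (p + ((v x - p.[x]) / w.[x])%:P * w) => y; rewrite !hornerE inE.
have [-> _|_ /= ys] := eqVneq y x.
  by rewrite divfK ?subrKC// -/(root w x) root_prod_XsubC.
by rewrite ps// [w.[y]](rootP _) ?mulr0 ?addr0// root_prod_XsubC.
Qed.

(** Induction along Horner's scheme: half of [e] goes to the constant term, the other half, divided
    by the bound [M] of [s], to the quotient by ['X]. *)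
Lemma rat_poly_approx (R : realType) (s : seq R) (p : {poly R}) (e : R) :
  0 < e -> exists q : {poly rat},
    forall x, x \in s -> `|p.[x] - (map_poly ratr q).[x]| < e.
Proof.
pose M := 1 + \sum_(x <- s) `|x|.
have M0 : 0 < M by rewrite ltr_pwDl// sumr_ge0.
have sM x : x \in s -> `|x| <= M.
  by move=> xs; rewrite /M (big_rem x)//= addrCA lerDl addr_ge0// sumr_ge0.
elim/poly_ind: p e => [|p c IHp] e e0.
  by exists 0 => x _; rewrite rmorph0 horner0 subrr normr0.
have [|q qp] := IHp (e / 2 / M); first by rewrite !divr_gt0.
have [r] : exists r : rat, c - e / 2 < ratr r < c + e / 2.
  by have [r] := rat_in_itvoo (ltac:(lra) : c - e / 2 < c + e / 2); exists r.
move=> /andP[rc cr].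
exists (q * 'X + r%:P) => x xs.
rewrite rmorphD rmorphM/= map_polyX map_polyC/= !hornerE.
rewrite (_ : _ - _ = (p.[x] - (map_poly ratr q).[x]) * x + (c - ratr r));
  last by ring.
apply: le_lt_trans (ler_normD _ _) _.
rewrite [ltRHS]splitr; apply: ler_ltD; last by rewrite ltr_distlC; lra.
rewrite normrM -[leRHS](divfK (lt0r_neq0 M0)) ler_pM// ?sM//.
exact/ltW/qp.
Qed.

Lemma Cp_hattori_separable (R : realType) (A : set R) :
  separable (Cp R (hattori A)).
Proof.
have pc (q : {poly rat}) :
    continuous (horner (map_poly ratr q : {poly R}) : hattori A -> R).
  exact/hattori_continuous/continuous_horner.
pose d q : Cp R (hattori A) := mkcts (pc q).
exists (range d); first exact: card_le_trans (card_image_le _ _) (countableP _).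
move=> U [f Uf] oU.
have [s [e [e0 sU]]] := Cp_nbhs_basis (open_nbhs_nbhs (conj oU Uf)).
have [p ps] := @poly_interpolation R s f.
have [q qs] := rat_poly_approx s p e0.
exists (d q); split; last by exists q.
by apply: sU => x xs; rewrite -ps//; exact: qs.
Qed.

(** * Cantor scheme of balls with ordered images *)

Section cantor_scheme.
Context (R : realType) (Y : metricType R) (f : Y -> R).

(** Uncountability is measured after applying [f], which may collapse an uncountable ball to a
    countable set. *)
Definition condensation (y : Y) :=
  forall e : R, 0 < e -> ~ countable (f @` ball y e).

Lemma countable_noncondensation :
  separable Y -> countable (f @` [set y | ~ condensation y]).
Proof.
move=> [D cD denseD].
(* Emptying [W d k] when the image is uncountable keeps the union countable; a ball around [d] with
   radius below [e / 2] that contains [y] lies in [ball y e], so its image survives. *)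
pose W d (k : nat) : set R :=
  if `[< countable (f @` ball d k.+1%:R^-1) >] then f @` ball d k.+1%:R^-1
  else set0.
apply: (@sub_countable _ _ _ (\bigcup_(d in D) \bigcup_k W d k)); last first.
  apply: bigcup_countable => // d _; apply: bigcup_countable => // k _.
  by rewrite /W; case: ifPn => [/asboolP//|_]; exact: countable0.
apply: subset_card_le => _ [y ncy <-].
have [e [e0 ce]] : exists e : R, 0 < e /\ countable (f @` ball y e).
  apply: contrapT => H; apply: ncy => e e0 ce; apply: H; by exists e.
have [k ke] : exists k : nat, k.+1%:R^-1 < e / 2.
  have e20 : 0 < e / 2 by exact: divr_gt0.
  have [k _ /(_ k (leqnn k)) ?] := near_infty_natSinv_lt (PosNum e20).
  by exists k.
have k0 : 0 < k.+1%:R^-1 :> R by rewrite invr_gt0.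
have [||d [yd Dd]] := denseD (ball y k.+1%:R^-1)°.
- by exists y; exact: nbhsx_ballx.
- exact: open_interior.
exists d => //; exists k => //; move: yd => /interior_subset yd.
have dy : ball d k.+1%:R^-1 `<=` ball y e.
  move=> z dz; apply: le_ball (ball_triangle yd dz).
  by rewrite [leRHS]splitr lerD// ltW.
rewrite /W asboolT; last first.
  exact: sub_countable (subset_card_le (image_subset f dy)) ce.
by exists y => //; exact: ball_sym.
Qed.

(** Were [f] constant on the condensation points near [y], a small ball would have countable image.
    Two values thus occur, and continuity separates them at their midpoint. The doubled radii leave
    room for limits of centres. *)
Lemma condensation_split (y : Y) (e : R) :
  separable Y -> continuous f -> condensation y -> 0 < e ->
  exists s : bool -> Y * R,
    (forall b, [/\ condensation (s b).1, 0 < (s b).2, (s b).2 <= e / 2 &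
                   ball (s b).1 (s b).2 `<=` ball y e]) /\
    (forall u v, ball (s false).1 (2 * (s false).2) u ->
                 ball (s true).1 (2 * (s true).2) v -> f u < f v).
Proof.
move=> sepY fc cy e0.
have [u [v [yu cu yv cv uv]]] : exists u v,
    [/\ (ball y e)° u, condensation u, (ball y e)° v, condensation v &
        f u < f v].
  apply: contrapT => H; apply: (cy (e / 2)); first exact: divr_gt0.
  have bint z : ball y (e / 2) z -> (ball y e)° z.
    move=> yz; apply/nbhs_ballP; exists (e / 2); first exact: divr_gt0.
    by move=> w zw; rewrite [e]splitr; exact: ball_triangle yz zw.
  pose C := f @` (ball y (e / 2) `&` condensation).
  have sC : is_subset1 C.
    move=> _ _ [u [yu cu] <-] [v [yv cv] <-]; apply/eqP.
    apply: contrapT => /negP.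
    rewrite neq_lt => /orP[] uv; apply: H;
      [exists u, v | exists v, u]; split=> //; exact: bint.
  pose N := f @` [set y | ~ condensation y].
  apply: (@sub_countable _ _ _ (\bigcup_b if b then C else N)).
    apply: subset_card_le => _ [z yz <-].
    by have [cz|ncz] := pselect (condensation z); [exists true|exists false];
      rewrite //; exists z.
  apply: bigcup_countable => // -[] _; last exact: countable_noncondensation.
  apply/countable_injP; exists (fun=> 0%N) => a b; rewrite !inE => Ca Cb _.
  exact: sC.
pose r := (f v - f u) / 2.
have r0 : 0 < r by rewrite divr_gt0// subr_gt0.
have [d d0 [du dfu]] : exists2 d : R, 0 < d &
    ball u d `<=` ball y e /\ forall z, ball u d z -> f z < f u + r.
  have : nbhs u (ball y e `&` f @^-1` ball (f u) r).
    by apply: filterI; [|exact: fc (nbhsx_ballx _ _ r0)].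
  move=> /nbhs_ballP[d /= d0 ud]; exists d => //; split=> z /ud[] //= _.
  by rewrite /ball/= ltr_distlC => /andP[].
have [t t0 [tv tfv]] : exists2 d : R, 0 < d &
    ball v d `<=` ball y e /\ forall z, ball v d z -> f v - r < f z.
  have : nbhs v (ball y e `&` f @^-1` ball (f v) r).
    by apply: filterI; [|exact: fc (nbhsx_ballx _ _ r0)].
  move=> /nbhs_ballP[d' /= d'0 ud]; exists d' => //; split=> z /ud[] //= _.
  by rewrite /ball/= ltr_distlC => /andP[].
(* The first term fits the doubled balls into those of radii [d] and [t]; the second halves the
   radius at each level. *)
pose m := Num.min (Num.min d t / 2) (e / 2).
have m0 : 0 < m by rewrite !lt_min !divr_gt0// lt_min d0 t0.
have [md mt me] : [/\ 2 * m <= d, 2 * m <= t & m <= e / 2].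
  rewrite /m; split; rewrite ?ge_min ?lexx ?orbT//.
    by rewrite mulrC -ler_pdivlMr// !ge_min ler_pM2r// ge_min lexx.
  by rewrite mulrC -ler_pdivlMr// !ge_min ler_pM2r// ge_min lexx orbT.
exists (fun b => (if b then v else u, m)); split=> [[]|] /=.
- by split=> // z vz; apply: tv; apply: le_ball vz; lra.
- by split=> // z vz; apply: du; apply: le_ball vz; lra.
- move=> w z /(le_ball md) /dfu uw /(le_ball mt) /tfv vz.
  by apply: lt_trans uw (le_lt_trans _ vz); rewrite /r; lra.
Qed.

End cantor_scheme.

Lemma cantor_cylinder_nbhs (a : cantor_space) (n : nat) :
  nbhs a [set b : cantor_space | forall i, (i < n)%N -> b i = a i].
Proof.
elim: n => [|n IHn].
  by rewrite (_ : mkset _ = setT) ?eqEsubset//; exact: filterT.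
have an : nbhs a [set b : cantor_space | b n = a n].
  have an : nbhs (a n) [set a n] by exact: discrete_set1.
  exact: (@proj_continuous _ (fun _ : nat => bool) n a _ an).
apply: filterS (filterI IHn an) => b [bi bn] i; rewrite ltnS leq_eqVlt.
by move=> /predU1P[->|/bi].
Qed.

(** Each sequence selects a branch of nested balls, and [phi] is [f] at the limit of their centres.
    At the first difference of two sequences the branches enter balls with ordered images. *)
Lemma lex_monotone_cantor_map (R : realType) (Y : metricType R) (f : Y -> R) :
  complete_metric Y -> separable Y -> continuous f -> ~ countable (range f) ->
  exists phi : cantor_space -> R,
    [/\ continuous phi, (forall a, range f (phi a)) &
        forall a b n, (forall i, (i < n)%N -> a i = b i) ->
          a n = false -> b n = true -> phi a < phi b].
Proof.
move=> cY sY fc ncf.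
have [y0 cy0] : exists y0, condensation f y0.
  apply: contrapT => /forallNP H; apply: ncf; apply: sub_countable
    (countable_noncondensation f sY).
  by apply: subset_card_le => _ [y _ <-]; exists y => //; exact: H.
pose ok (p : Y * R) := condensation f p.1 /\ 0 < p.2.
have /choice[s sP] : forall p, exists s : bool -> Y * R, ok p ->
    (forall b, [/\ ok (s b), (s b).2 <= p.2 / 2 &
                   ball (s b).1 (s b).2 `<=` ball p.1 p.2]) /\
    (forall u v, ball (s false).1 (2 * (s false).2) u ->
                 ball (s true).1 (2 * (s true).2) v -> f u < f v).
  move=> p.
  have [[cp p0]|nok] := pselect (ok p); last by exists (fun=> p).
  have [s [sP sf]] := condensation_split sY fc cp p0.
  by exists s => _; split=> // b; have [] := sP b.
pose fix node (a : cantor_space) n :=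
  if n is m.+1 then s (node a m) (a m) else (y0, 1).
have node_ok a n : ok (node a n).
  elim: n => [|n IHn] /=; first by split=> /=.
  by have [/(_ (a n))[]] := sP _ IHn.
have node_small a n : (node a n).2 <= 2^-1 ^+ n.
  elim: n => [|n IHn] /=; first by rewrite expr0.
  have [/(_ (a n))[_ le2 _] _] := sP _ (node_ok a n).
  by apply: le_trans le2 _; rewrite exprSr ler_pM2r.
have node_nested a m n : (m <= n)%N ->
    ball (node a n).1 (node a n).2 `<=` ball (node a m).1 (node a m).2.
  elim: n => [|n IHn]; first by rewrite leqn0 => /eqP ->.
  rewrite leq_eqVlt => /predU1P[-> //|/IHn]; apply: subset_trans.
  by have [/(_ (a n))[_ _ ]] := sP _ (node_ok a n).
have node_prefix a b n :
    (forall i, (i < n)%N -> a i = b i) -> node a n = node b n.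
  elim: n => // n IHn ab /=; rewrite IHn ?ab// => i ilt.
  by apply: ab; exact: ltnW.
have small (e : R) : 0 < e -> exists n, 4 * 2^-1 ^+ n < e.
  move=> e0; have e40 : 0 < e / 4 by exact: divr_gt0.
  have : (fun n => 2^-1 ^+ n : R) @ \oo --> 0.
    by apply: cvg_expr; rewrite gtr0_norm//; lra.
  move/cvgrPdist_lt => /(_ _ e40)[n _ /(_ n (leqnn n))].
  rewrite sub0r normrN ger0_norm ?exprn_ge0// => ne.
  by exists n; rewrite mulrC -ltr_pdivlMr.
(* The limit of the centres is only in the closure of each ball, hence the doubled radius. *)
have /choice[l lP] : forall a : cantor_space, exists y, forall n,
    ball (node a n).1 (2 * (node a n).2) y.
  move=> a.
  have centers m n : (m <= n)%N -> ball (node a m).1 (node a m).2 (node a n).1.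
    move=> mn; apply: (node_nested _ _ _ mn); apply: ballxx.
    by have [] := node_ok a n.
  have [|y ly] := cY (fun n => (node a n).1).
    apply: cauchy_exP => e e0; have [m me] := small _ e0.
    exists (node a m).1; exists m => // n /= mn.
    apply: le_ball (centers _ _ mn); apply: le_trans (node_small a m) _.
    apply/ltW/(le_lt_trans _ me); rewrite ler_peMl ?exprn_ge0//; lra.
  exists y => m.
  have [_ m0] := node_ok a m.
  have [k _ kP] := (cvg_ball ly m0).
  rewrite (_ : 2 * _ = (node a m).2 + (node a m).2); last by rewrite mulr_natl.
  apply: ball_triangle (centers m (maxn m k) (leq_maxl _ _)) (ball_sym _).
  by apply: kP => /=; exact: leq_maxr.
(* Both limits are within [2 * 2^-1 ^+ n] of the common centre. *)
have l_close a b n : (forall i, (i < n)%N -> a i = b i) ->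
    ball (l a) (4 * 2^-1 ^+ n) (l b).
  move=> ab; have := lP b n; rewrite -(node_prefix a b n ab) => lb.
  apply: le_ball (ball_triangle (ball_sym (lP a n)) lb).
  by have := node_small a n; lra.
exists (f \o l); split=> [a|a|a b n ab an bn] /=; last 1 first.
- have := lP a n.+1; have := lP b n.+1; rewrite /= -(node_prefix a b n ab) an bn.
  by move=> bP aP; have [_] := sP _ (node_ok a n); exact.
- apply: continuous_comp; last exact: fc.
  apply/cvg_ballP => e e0; have [n ne] := small _ e0.
  apply: filterS (cantor_cylinder_nbhs a n) => b ba.
  by apply: le_ball (ltW ne) _ _; apply: l_close => i /ba ->.
- by exists (l a).
Qed.

(** * Finite-point neighbourhoods, half-lines and cuts of the line *)

Lemma Cp_nbhs_finite (R : realType) (X : topologicalType) (f : Cp R X)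
    (s : seq X) (e : R) : 0 < e ->
  nbhs f [set g : Cp R X | forall x, x \in s -> `|f x - g x| < e].
Proof.
move=> e0; elim: s => [|x s IHs].
  by rewrite (_ : mkset _ = setT) ?eqEsubset//; exact: filterT.
have /cvgrPdist_lt/(_ _ e0) fx := @Cp_eval_continuous R X x f.
apply: filterS (filterI fx IHs) => g [gx gs] z.
by rewrite inE => /predU1P[->|/gs].
Qed.

(** This is clopenness of the half-line from [c], phrased as local constancy. The case [t = c] uses
    [~ A c], through the neighbourhood [[c, c + 1[]. *)
Lemma hattori_nbhs_ge (R : realType) (A : set R) (c t : R) : ~ A c ->
  \forall s \near (t : hattori A), (c <= (s : R)) = (c <= t).
Proof.
move=> nAc; have [tc|ct] := ltP t c.
  exists (c - t) => /=; first by rewrite subr_gt0.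
  move=> s; rewrite /hattori_base; case: ifP => _; rewrite /= in_itv/= => ts;
    by apply/negbTE; rewrite -ltNge; lra.
have [d d0 dc] : exists2 d, 0 < d & forall s, hattori_base A t d s -> c <= s.
  have [<-|ct'] := eqVneq c t.
    exists 1 => // s; rewrite /hattori_base memNset//= in_itv/=.
    by case/andP.
  exists (t - c) => [|s]; first by rewrite subr_gt0 lt_neqAle ct' ct.
  by rewrite /hattori_base; case: ifP => _; rewrite /= in_itv/= => ts; lra.
by exists d => //= s /dc ->.
Qed.

Lemma hattori_continuous_itv (R : realType) (A : set R) (a b : R) :
  ~ A a -> ~ A b ->
  continuous ((fun t : R => (a <= t < b)%R%:R) : hattori A -> R).
Proof.
move=> nAa nAb t; have tF := @nbhs_filter (hattori A) t.
apply: cvg_near_cst.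
apply: filterS2 (hattori_nbhs_ge t nAa) (hattori_nbhs_ge t nAb) => s.
by rewrite !ltNge => -> ->.
Qed.

(** The cut is at the infimum [c] of the points where [G] holds: [G] jumps in every interval around
    [c], so [c] lies in [K], and right constancy settles [G c]. *)
Lemma cut_in_closed (R : realType) (K : set R) (G : R -> bool) (lo hi : R) :
  closed K -> {homo G : s t / s <= t >-> s ==> t} -> ~~ G lo -> G hi ->
  (forall s t, s < t -> ~~ G s -> G t -> exists2 k, K k & s < k <= t) ->
  (forall c, K c -> exists2 e, 0 < e & forall t, c <= t < c + e -> G t = G c) ->
  exists2 c, K c & forall t, G t = (c <= t).
Proof.
move=> clK Gmono Glo Ghi jumpK Krc.
pose E := [set t | G t]; pose c := inf E.
have infE : has_inf E.
  split; first by exists hi.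
  exists lo => t Gt; rewrite leNgt; apply: contra Glo => /ltW /Gmono.
  by rewrite /E/= in Gt; rewrite Gt.
have Glt t : t < c -> G t = false.
  by move=> tc; apply: contraTF tc => Gt; rewrite -leNgt (ge_inf infE.2).
have Ggt t : c < t -> G t.
  move=> ct; have [s Gs st] := inf_lt infE.1 ct.
  by move: (Gmono _ _ (ltW st)); rewrite [G s]Gs.
have Kc : K c.
  apply: clK => U /nbhs_ballP[e /= e0 eU].
  have [|||k Kk /andP[ck kc]] := jumpK (c - e / 2) (c + e / 2); first by lra.
  - by rewrite Glt//; lra.
  - by apply: Ggt; lra.
  by exists k; split=> //; apply: eU; rewrite /ball/= ltr_distlC; lra.
exists c => // t; have [e e0 ce] := Krc _ Kc.
have [/Glt//|/Ggt//|->] := ltgtP t c.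
rewrite -(ce (c + e / 2)); last by lra.
by apply: Ggt; lra.
Qed.

(** * Closed families of indicators of intervals through a common point *)

Section antimonotone_intervals.
Context (R : realType) (A : set R) (I : Type) (x y : I -> R) (m : R).
Hypotheses (xA : forall a, ~ A (x a)) (yA : forall a, ~ A (y a)).
Hypotheses (cptx : compact (range x)) (cpty : compact (range y)).
Hypotheses (xm : forall a, x a <= m) (my : forall a, m < y a).
Hypothesis anti : forall a b, (x a < x b) = (y b < y a).

Definition itv_Cp (a : I) : Cp R (hattori A) :=
  mkcts (hattori_continuous_itv (@xA a) (@yA a)).

Lemma itv_CpE a t : itv_Cp a t = (x a <= t < y a)%R%:R.
Proof. by []. Qed.

(** Order part of the closedness proof: [F] is the limit of the indicator
    functions of [[x a, y a[], [a] in [B]. *)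
Lemma itv_limit (B : set I) (F : R -> bool) :
  (forall s : seq R,
    exists2 a, B a & forall t, t \in s -> F t = (x a <= t < y a)) ->
  (forall c, ~ A c ->
    exists2 e, 0 < e & forall t, c <= t < c + e -> F t = F c) ->
  exists2 a, B a & forall t, F t = (x a <= t < y a).
Proof.
move=> FP Frc.
have F2 s t : exists2 a, B a & F s = (x a <= s < y a) /\ F t = (x a <= t < y a).
  have [a Ba aP] := FP [:: s; t].
  by exists a => //; split; apply: aP; rewrite !inE eqxx ?orbT.
have Fm : F m by have [a _ [-> _]] := F2 m m; rewrite xm my.
have [lo loP] : exists lo, forall a, lo < x a.
  have [M [_ MP]] := compact_bounded cptx; exists (- (M + 1) - 1) => a.
  have /ler_normlP[] : `|x a| <= M + 1 by apply: MP; [lra|exists a].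
  by lra.
have [hi hiP] : exists hi, forall a, y a < hi.
  have [M [_ MP]] := compact_bounded cpty; exists (M + 1 + 1) => a.
  have /ler_normlP[] : `|y a| <= M + 1 by apply: MP; [lra|exists a].
  by lra.
(* Truncation at [m], which lies in every interval, hides the right endpoints and leaves a monotone
   cut. *)
have [_ [p _ <-] pP] : exists2 c, range x c &
    forall t, F (Num.min t m) = (c <= t).
  apply: (@cut_in_closed _ _ _ lo m).
  - exact: compact_closed.
  - move=> s t st; have [a _ [-> ->]] := F2 (Num.min s m) (Num.min t m).
    apply/implyP => /andP[xs _]; rewrite (le_trans xs) ?le_min2//=.
    by rewrite (le_lt_trans _ (my a))// ge_min lexx orbT.
  - have [a _ [-> _]] := F2 (Num.min lo m) m.
    by rewrite leNgt gt_min loP.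
  - by rewrite minxx.
  - move=> s t st; have [a _ [-> ->]] := F2 (Num.min s m) (Num.min t m).
    have my' u : Num.min u m < y a by rewrite gt_min my orbT.
    rewrite !my' !andbT -ltNge gt_min (ltNge m) xm orbF le_min.
    move=> sx /andP[xt _].
    by exists (x a); [exists a|rewrite sx].
  - move=> _ [a _ <-]; have [e e0 ae] := Frc _ (@xA a).
    exists e => // t /andP[xt te].
    rewrite (min_idPl (xm a)); apply: ae.
    by rewrite le_min xt xm gt_min te.
(* Symmetrically, the maximum with [m] hides the left endpoints; negation makes the cut
   increasing. *)
have [_ [q _ <-] qP] : exists2 c, range y c &
    forall t, ~~ F (Num.max t m) = (c <= t).
  apply: (@cut_in_closed _ _ _ m hi).
  - exact: compact_closed.
  - move=> s t st; have [a _ [-> ->]] := F2 (Num.max s m) (Num.max t m).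
    have xm' u : x a <= Num.max u m by rewrite le_max xm orbT.
    rewrite !xm' /= -!leNgt; apply/implyP => ys; rewrite (le_trans ys)//.
    by rewrite le_max2.
  - by rewrite maxxx negbK.
  - have [a _ [-> _]] := F2 (Num.max hi m) m.
    by rewrite gt_max (ltNge hi) (ltW (hiP a)) andbF.
  - move=> s t st; have [a _ [-> ->]] := F2 (Num.max s m) (Num.max t m).
    have xm' u : x a <= Num.max u m by rewrite le_max xm orbT.
    rewrite !xm' /= negbK -leNgt gt_max => /andP[sy _].
    rewrite le_max (leNgt (y a) m) my orbF => yt.
    by exists (y a); [exists a|rewrite sy].
  - move=> _ [a _ <-]; have [e e0 ae] := Frc _ (@yA a).
    exists e => // t /andP[yt te].
    rewrite (max_idPl (ltW (my a))) (max_idPl (ltW (lt_le_trans (my a) yt))).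
    by rewrite ae// yt.
have FE t : F t = (x p <= t < y q).
  have [tm|mt] := leP t m.
    by rewrite -pP (min_idPl tm) (le_lt_trans tm (my q)) andbT.
  rewrite (le_trans (xm p) (ltW mt)) ltNge -qP negbK.
  by rewrite (max_idPl (ltW mt)).
have xy a b : x a < y b by exact: le_lt_trans (xm a) (my b).
have xyW a b : x a <= y b by exact/ltW.
(* The endpoints found so far may come from different indices. Agreement of [a] with [F] there gives
   [x a <= x p] and [y a <= y q]. *)
have [a Ba []] := F2 (x p) (y q).
rewrite !FE !xy !andbT lexx ltxx andbF xyW/= => /esym xap /esym/negbT.
rewrite -leNgt => yaq.
have anti' b c : (x b <= x c) = (y c <= y b) by rewrite !leNgt anti.
have ypq : y p = y q.
  have ypa : y p <= y a by rewrite -anti'.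
  (* If [y p < y q], then [x q < x p], and agreement at [x q] and [y p] gives [b] with
     [x q < x b < x p] and [y p < y b < y q]. Agreement at [x b] and [y b] then gives [c] with
     [x b < x c] and [y b < y c], against [anti]. *)
  apply/eqP; rewrite eq_le (le_trans ypa yaq)/= leNgt -anti; apply/negP => xqp.
  have [b _ []] := F2 (x q) (y p).
  rewrite !FE !xy !andbT !xyW/= leNgt xqp/= -anti xqp => /esym/negbT.
  rewrite -ltNge => xqb /esym ypb.
  have [c _ []] := F2 (x b) (y b).
  rewrite !FE !xy !andbT !xyW/= -anti xqb => + /esym ybc.
  by rewrite leNgt anti ypb => /esym/negbT; rewrite -ltNge anti ltNge (ltW ybc).
exists a => // t; rewrite FE.
have ya : y a = y q by apply/eqP; rewrite eq_le yaq -ypq -anti'.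
suff -> : x a = x p by rewrite ya.
by apply/eqP; rewrite eq_le xap anti' ya ypq lexx.
Qed.

(** Pointwise limits of functions with values 0 and 1 again have such values, and continuity off [A]
    makes them constant to the right, as [itv_limit] demands. *)
Lemma closed_itv_Cp (B : set I) : closed (itv_Cp @` B).
Proof.
move=> f clf.
have fP (s : seq R) (e : R) : 0 < e -> exists2 a, B a &
    forall t, t \in s -> `|f t - (x a <= t < y a)%R%:R| < e.
  move=> e0; have [_ [[a Ba <-] aP]] := clf _ (Cp_nbhs_finite f s e0).
  by exists a.
pose F t := f t == 1.
have fF t : f t = (F t)%:R.
  rewrite /F; case: eqVneq => //= f1; apply/eqP/negPn/negP => f0.
  (* This tolerance rules out both 0 and 1 as approximating values. *)
  have [|a _ /(_ t)] := fP [:: t] (Num.min `|f t| `|f t - 1|).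
    by rewrite lt_min !normr_gt0 f0 subr_eq0.
  rewrite mem_head => /(_ isT); case: (_ <= _ < _).
    by rewrite lt_min ltxx andbF.
  by rewrite subr0 lt_min ltxx.
have [||a Ba aP] := @itv_limit B F; last first.
- by exists a => //; apply/continuousEP => t; rewrite itv_CpE fF aP.
- move=> c Ac; have /cvgrPdist_lt/(_ _ ltr01)[e /= e0 ce] := @cts_fun _ _ f c.
  exists e => // t ct; have := ce t.
  rewrite /hattori_base memNset//= in_itv/= ct.
  by move=> /(_ isT); rewrite !fF; do 2 case: (F _);
    rewrite ?subr0 ?sub0r ?normrN ?normr1 ?ltxx.
- move=> s; have [a Ba aP] := fP s 1 ltr01; exists a => // t /aP.
  by rewrite fF; case: (F t); case: (_ <= _ < _);
    rewrite ?subr0 ?sub0r ?normrN ?normr1 ?ltxx.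
Qed.

Lemma itv_Cp_injective : injective x -> injective itv_Cp.
Proof.
move=> xinj a b /continuousEP ab; apply/xinj/eqP; rewrite eq_le.
have xy c d : x c < y d by exact: le_lt_trans (xm c) (my d).
have := ab (x b); have := ab (x a); rewrite !itv_CpE !lexx !xy !andbT.
move=> /eqP; rewrite eqr_nat; case: (x b <= x a) => // _ /eqP.
by rewrite eqr_nat; case: (x a <= x b).
Qed.

End antimonotone_intervals.

(** * Endpoints indexed by the Cantor space *)

Lemma lexP (a b : nat -> bool) :
  a = b \/ exists n, (forall i, (i < n)%N -> a i = b i) /\ b n = ~~ a n.
Proof.
have [|/forallNP ab] := pselect (exists n, a n != b n); last first.
  by left; apply/funext => n; apply/eqP/negP => /negP; exact: ab.
move=> /ex_minnP[n abn nP]; right; exists n; split=> [i ilt|].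
  by apply: contraTeq ilt => /nP; rewrite -leqNgt.
by move: abn; case: (a n); case: (b n).
Qed.

Lemma compact_cantor_image (R : realType) (phi : cantor_space -> R) (b : bool) :
  continuous phi -> compact (phi @` [set a : cantor_space | a 0%N = b]).
Proof.
move=> phic; apply: (@continuous_compact cantor_space R).
  exact: continuous_subspaceT.
apply: subclosed_compact cantor_space_compact _ => //.
apply: (@preimage_closed cantor_space bool (fun a => a 0%N) [set b]).
  by move=> a _; exact: (@proj_continuous _ (fun _ : nat => bool) 0%N a).
exact: discrete_closed.
Qed.

Theorem theorem14 (R : realType) (A : set R)
    (uncountableCA : ~ countable (~` A)) (analyticCA : analytic (~` A)) :
  ~ normal_space (Cp R (hattori A)).
Proof.
have [Y [f [cY sY fc fA]]] := analyticCA.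
have ncf : ~ countable (range f) by rewrite fA.
have [phi [phic phiA phi_lt]] := lex_monotone_cantor_map cY sY fc ncf.
rewrite fA in phiA.
pose bcons b (a : nat -> bool) : cantor_space :=
  fun n => if n is k.+1 then a k else b.
pose x a := phi (bcons false a).
pose y a := phi (bcons true (fun n => ~~ a n)).
have lt_bcons b (a c : nat -> bool) n : (forall i, (i < n)%N -> a i = c i) ->
    a n = false -> c n = true -> phi (bcons b a) < phi (bcons b c).
  by move=> ac an cn; apply: (phi_lt _ _ n.+1) => // -[|i] //= /ac.
have anti_lt a c n : (forall i, (i < n)%N -> a i = c i) -> a n = false ->
    c n = true -> (x a < x c) /\ (y c < y a).
  move=> ac an cn; split; apply: (lt_bcons _ _ _ n) => // [i /ac ->//||];
  by rewrite ?an ?cn.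
have anti a c : (x a < x c) = (y c < y a).
  have [->|[n [ac]]] := lexP a c; first by rewrite !ltxx.
  case an: (a n) => cn; last by have [-> ->] := anti_lt _ _ _ ac an cn.
  have ca i : (i < n)%N -> c i = a i by move=> /ac ->.
  have [xca yac] := anti_lt _ _ _ ca cn an.
  by rewrite (lt_gtF xca) (lt_gtF yac).
(* The constant sequence [true] is lexicographically last, so [m] is the largest left endpoint; the
   leading bit puts it below every [y a]. *)
pose m := x (fun=> true).
have xm a : x a <= m.
  have [->//|[n [ac an]]] := lexP a (fun=> true).
  by apply/ltW/(lt_bcons _ _ _ n) => //; apply/negbTE/esym.
have my a : m < y a by apply: (phi_lt _ _ 0%N).
have cptx : compact (range x).
  rewrite (_ : range x = phi @` [set a : cantor_space | a 0%N = false]).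
    exact: compact_cantor_image.
  apply/seteqP; split=> _ [a /= a0 <-]; first by exists (bcons false a).
  exists (fun n => a n.+1) => //; congr phi; apply/funext => -[|n] //=.
have cpty : compact (range y).
  rewrite (_ : range y = phi @` [set a : cantor_space | a 0%N = true]).
    exact: compact_cantor_image.
  (* Bitwise negation is an involution, so [y] still covers the whole half with leading bit
     [true]. *)
  apply/seteqP; split=> _ [a /= a0 <-].
    by exists (bcons true (fun n => ~~ a n)).
  exists (fun n => ~~ a n.+1) => //; congr phi; apply/funext => -[|n] //=.
  exact: negbK.
have xinj : injective x.
  move=> a c xac; have [//|[n [ac]]] := lexP a c.
  case an: (a n) => cn; last first.
    by have [] := anti_lt _ _ _ ac an cn; rewrite xac ltxx.
  have ca i : (i < n)%N -> c i = a i by move=> /ac ->.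
  by have [] := anti_lt _ _ _ ca cn an; rewrite xac ltxx.
pose g := @itv_Cp R A _ x y (fun a => phiA _) (fun a => phiA _).
apply: (@separable_closed_discrete_not_normal _ g).
- exact: Cp_hattori_separable.
- exact: itv_Cp_injective.
- exact: closed_itv_Cp.
Qed.
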